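(* Let $a:\mathbb{N}\times\mathbb{N}\to\mathbb{C}$ be an arithmetic function of two variables. If the series $$A(q_1,q_2):=q_1q_2\sum_{k_1,k_2=1}^\infty a(k_1q_1,k_2q_2)$$ converges for every $q_1,q_2\in\mathbb{N}$, then for $f(q_1,q_2)=\sum_{d_1\mid q_1,\,d_2\mid q_2}A(d_1,d_2)\mu(q_1/d_1)\mu(q_2/d_2)$ we have, for all $q_1,q_2\in\mathbb{N}$, $$f(q_1,q_2)=\sum_{n_1,n_2=1}^\infty a(n_1,n_2)\,c_{q_1}(n_1)\,c_{q_2}(n_2).$$
   Context: $\mathbb{N}=\{1,2,\dots\}$. $c_q(n)=\sum_{1\le k\le q,\,(k,q)=1}\exp(2\pi i kn/q)$ is the Ramanujan sum; $\mu$ is the Möbius function. Double series $\sum_{k_1,k_2=1}^\infty$ are understood as limits of the partial sums over $k_1\le x$, $k_2\le y$ as $x,y\to\infty$. *)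

(* Defs.v *)
From HB Require Import structures.
From mathcomp Require Import all_boot all_order all_algebra.
From mathcomp Require Import all_classical all_reals all_analysis.
From mathcomp Require Export complex.
Set Implicit Arguments.
Unset Strict Implicit.
Unset Printing Implicit Defensive.
Import Order.TTheory GRing.Theory Num.Theory.
Import numFieldNormedType.Exports.
Local Open Scope classical_set_scope.
Local Open Scope ring_scope.
Local Open Scope complex_scope.

Definition moebius (n : nat) : int :=
  if (0 < n)%N && all (fun p => logn p n == 1%N) (primes n)
  then (-1) ^+ size (primes n) else 0.

Definition cexp (R : realType) (z : R[i]) : R[i] :=
  (expR (complex.Re z))%:C * (cos (complex.Im z) +i* sin (complex.Im z)).

Definition ramanujan_sum (R : realType) (q n : nat) : R[i] :=
  \sum_(1 <= k < q.+1 | coprime k q)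
    cexp (2 * pi%:C * 'i%C * k%:R * n%:R / q%:R).

(* The topology on R[i] is the one induced by the complex modulus; it is carried
   by the alias R[i]^o. *)
Definition partial_sum2 (R : realType) (u : nat -> nat -> R[i])
    (xy : nat * nat) : R[i]^o :=
  \sum_(1 <= k1 < xy.1.+1) \sum_(1 <= k2 < xy.2.+1) u k1 k2.

(* Both bounds tend to infinity independently (Pringsheim). *)
Definition has_sum2 (R : realType) (u : nat -> nat -> R[i]) (s : R[i]) : Prop :=
  partial_sum2 u xy @[xy --> (\oo, \oo)] --> (s : R[i]^o).

Definition summable2 (R : realType) (u : nat -> nat -> R[i]) : Prop :=
  cvg (partial_sum2 u xy @[xy --> (\oo, \oo)]).

Definition sum2 (R : realType) (u : nat -> nat -> R[i]) : R[i] :=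
  lim (partial_sum2 u xy @[xy --> (\oo, \oo)]).

Definition multiples_sum (R : realType) (a : nat -> nat -> R[i])
    (q1 q2 : nat) : R[i] :=
  q1%:R * q2%:R * sum2 (fun k1 k2 => a (k1 * q1)%N (k2 * q2)%N).

Definition moebius_transform2 (R : realType) (A : nat -> nat -> R[i])
    (q1 q2 : nat) : R[i] :=
  \sum_(d1 <- divisors q1) \sum_(d2 <- divisors q2)
    A d1 d2 * (moebius (q1 %/ d1)%N)%:~R * (moebius (q2 %/ d2)%N)%:~R.

(* Main.v *)
(** Detecting [coprime k q] by the Moebius function and summing over the roots
    of unity gives [c_q(n) = \sum_(d | q, d | n) d mu(q / d)].  The summand of
    the right-hand side is therefore a finite combination, over the divisors
    [d1] of [q1] and [d2] of [q2], of the restrictions of [a] to the pairs of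
    multiples of [d1] and [d2].  The partial sum of such a restriction up to
    [(x, y)] is the partial sum up to [(x / d1, y / d2)] of the series defining
    [A(d1, d2)], so the limit can be taken term by term. *)
Require Import Defs.
From mathcomp Require Import all_boot all_order all_algebra.
From mathcomp Require Import all_classical all_reals all_analysis.
From mathcomp Require Import ring lra.
Set Implicit Arguments.
Unset Strict Implicit.
Unset Printing Implicit Defensive.
Import Order.TTheory GRing.Theory Num.Theory.
Import numFieldNormedType.Exports.
Local Open Scope classical_set_scope.
Local Open Scope ring_scope.
Local Open Scope complex_scope.

Section BigDivisors.
Variables (T : Type) (idx : T) (op : Monoid.com_law idx).
Implicit Types (d m n p q x : nat) (P Q : pred nat) (F : nat -> T).

Lemma big_nat_dvdn d x F : (0 < d)%N ->
  \big[op/idx]_(1 <= k < x.+1 | (d %| k)%N) F k =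
  \big[op/idx]_(1 <= j < (x %/ d).+1) F (j * d)%N.
Proof.
move=> d_gt0; elim: x => [|x IHx]; first by rewrite div0n !big_geq.
rewrite big_mkcond big_nat_recr //= -big_mkcond IHx divnS //.
case: ifP => [d_x|_]; last by rewrite Monoid.mulm1 add0n.
rewrite add1n [RHS]big_nat_recr //=; congr (op _ (F _)).
by have := divnS x d_gt0; rewrite d_x add1n => <-; rewrite divnK.
Qed.

Lemma big_divisors_nat q P F : (0 < q)%N ->
  \big[op/idx]_(d <- divisors q | P d) F d =
  \big[op/idx]_(1 <= d < q.+1 | P d && (d %| q)%N) F d.
Proof.
move=> q_gt0; rewrite -big_filter -[RHS]big_filter; apply: perm_big.
apply: uniq_perm; rewrite ?filter_uniq ?divisors_uniq ?iota_uniq // => d.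
rewrite !mem_filter mem_index_iota -dvdn_divisors // -andbA.
congr (_ && _); apply/idP/idP => [d_q|/andP[]//].
by rewrite d_q (dvdn_gt0 q_gt0) //= ltnS dvdn_leq.
Qed.

Lemma eq_big_divisors m n P Q F : (0 < m)%N -> (0 < n)%N ->
  (forall d, (d %| m)%N && P d = (d %| n)%N && Q d) ->
  \big[op/idx]_(d <- divisors m | P d) F d =
  \big[op/idx]_(d <- divisors n | Q d) F d.
Proof.
move=> m_gt0 n_gt0 PQ; rewrite -big_filter -[RHS]big_filter; apply: perm_big.
apply: uniq_perm; rewrite ?filter_uniq ?divisors_uniq // => d.
by rewrite !mem_filter -!dvdn_divisors // andbC PQ andbC.
Qed.

Lemma big_divisors_multiples p q F : (0 < q)%N -> (p %| q)%N ->
  \big[op/idx]_(d <- divisors q | (p %| d)%N) F d =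
  \big[op/idx]_(e <- divisors (q %/ p)) F (e * p)%N.
Proof.
move=> q_gt0 p_q; have p_gt0 := dvdn_gt0 q_gt0 p_q.
rewrite big_divisors_nat // big_mkcondr big_nat_dvdn // -big_mkcond.
rewrite big_divisors_nat ?divn_gt0 ?(dvdn_leq q_gt0) //.
by apply: eq_bigl => e; rewrite dvdn_divRL.
Qed.

Lemma big_divisors_codiv q F : (0 < q)%N ->
  \big[op/idx]_(d <- divisors q) F d =
  \big[op/idx]_(d <- divisors q) F (q %/ d)%N.
Proof.
move=> q_gt0; rewrite -(big_map (divn q) predT F); apply: perm_big.
have codivK d : (d %| q)%N -> (q %/ (q %/ d))%N = d.
  by move=> d_q; rewrite divnA // mulKn.
apply: uniq_perm; rewrite ?divisors_uniq //.
  rewrite map_inj_in_uniq ?divisors_uniq // => d e.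
  by rewrite -!dvdn_divisors // => /codivK{2}<- /codivK{2}<- ->.
move=> d; rewrite -dvdn_divisors //; apply/idP/mapP => [d_q|[e]].
  by exists (q %/ d)%N; rewrite -?dvdn_divisors ?dvdn_div ?codivK.
by rewrite -dvdn_divisors // => e_q ->; exact: dvdn_div.
Qed.

End BigDivisors.

Section Moebius.
Implicit Types (d e m n p q : nat).

Lemma moebius_prime p : prime p -> moebius p = -1.
Proof.
by move=> p_pr; rewrite /moebius prime_gt0 // primes_prime //= logn_prime ?eqxx.
Qed.

Lemma moebius_sqr_dvdn p n : prime p -> (p ^ 2 %| n)%N -> moebius n = 0.
Proof.
move=> p_pr p2_n; rewrite /moebius; case: ifP => // /andP[n_gt0 /allP lg1].
have p_n : p \in primes n.
  by rewrite mem_primes p_pr n_gt0 (dvdn_trans _ p2_n) ?dvdn_exp.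
by move: p2_n; rewrite pfactor_dvdn // (eqP (lg1 p p_n)).
Qed.

Lemma moebiusM m n : coprime m n -> moebius (m * n) = moebius m * moebius n.
Proof.
have [->|m_gt0] := posnP m; first by rewrite mul0r.
have [->|n_gt0] := posnP n; first by rewrite muln0 mulr0.
move=> mn_coprime.
have primes_mn : perm_eq (primes (m * n)) (primes m ++ primes n).
  apply: uniq_perm => [||p]; first exact: primes_uniq.
    by rewrite cat_uniq !primes_uniq -coprime_has_primes ?mn_coprime.
  by rewrite primesM // mem_cat.
have all_logn1 k l : (0 < k)%N -> (0 < l)%N -> coprime k l ->
    all (fun p => logn p (k * l) == 1%N) (primes k) =
    all (fun p => logn p k == 1%N) (primes k).
  move=> k_gt0 l_gt0 kl_coprime; apply: eq_in_all => p.
  rewrite mem_primes => /and3P[_ _ p_k].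
  by rewrite lognM // [logn p l]logn_coprime ?addn0 // (coprime_dvdl p_k).
rewrite /moebius muln_gt0 m_gt0 n_gt0 (perm_size primes_mn) size_cat /=.
rewrite (perm_all _ primes_mn) all_cat all_logn1 // mulnC.
rewrite all_logn1 1?coprime_sym //.
by do 2![case: all]; rewrite ?mul0r ?mulr0 // exprD.
Qed.

Lemma moebiusM_prime p e : prime p ->
  moebius (e * p) = if (p %| e)%N then 0 else - moebius e.
Proof.
move=> p_pr; have [p_e|pNe] := boolP (p %| e)%N.
  by rewrite (moebius_sqr_dvdn p_pr) // expnS expn1 dvdn_mul.
by rewrite moebiusM 1?coprime_sym ?prime_coprime // (moebius_prime p_pr) mulrN1.
Qed.

(* For a prime [p %| m], the divisors [e] and [e * p] with [p] not dividing [e]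
   cancel, and the divisors divisible by [p ^ 2] contribute nothing. *)
Lemma sum_moebius m : (0 < m)%N ->
  \sum_(d <- divisors m) moebius d = (m == 1%N)%:R.
Proof.
move=> m_gt0; have [->|m_neq1] := eqVneq m 1%N; first by rewrite big_seq1.
pose p := pdiv m; have p_m : (p %| m)%N := pdiv_dvd m.
have p_pr : prime p by rewrite pdiv_prime // ltn_neqAle eq_sym m_neq1.
have p_gt0 := prime_gt0 p_pr.
have mp_gt0 : (0 < m %/ p)%N by rewrite divn_gt0 // dvdn_leq.
rewrite (bigID (fun d => p %| d)%N) /= big_divisors_multiples //.
have -> : \sum_(e <- divisors (m %/ p)) moebius (e * p) =
          - \sum_(e <- divisors (m %/ p) | ~~ (p %| e)%N) moebius e.
  rewrite -sumrN [RHS]big_mkcond; apply: eq_bigr => e _.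
  by rewrite moebiusM_prime // if_neg.
apply/eqP; rewrite addrC subr_eq0; apply/eqP/eq_big_divisors => // e.
have [_|pNe] := boolP (p %| e)%N; first by rewrite !andbF.
by rewrite dvdn_divRL // Gauss_dvd ?p_m ?andbT // coprime_sym prime_coprime.
Qed.

Lemma sum_moebius_dvdn q k : (0 < q)%N ->
  \sum_(d <- divisors q | (d %| k)%N) moebius d = (coprime k q)%:R.
Proof.
move=> q_gt0; have g_gt0 : (0 < gcdn k q)%N by rewrite gcdn_gt0 q_gt0 orbT.
rewrite -sum_moebius //; apply: eq_big_divisors => // d.
by rewrite andbT dvdn_gcd andbC.
Qed.

Lemma sum_coprime (V : pzRingType) q (r : seq nat) (F : nat -> V) : (0 < q)%N ->
  \sum_(k <- r | coprime k q) F k =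
  \sum_(d <- divisors q) (moebius d)%:~R * \sum_(k <- r | (d %| k)%N) F k.
Proof.
move=> q_gt0; under [RHS]eq_bigr do rewrite mulr_sumr big_mkcond.
rewrite exchange_big big_mkcond; apply: eq_bigr => k _.
rewrite -big_mkcond -mulr_suml -rmorph_sum sum_moebius_dvdn //=.
by case: coprime; rewrite ?mul1r ?mul0r.
Qed.

End Moebius.

Lemma sum_prim_root_expr (K : idomainType) (q : nat) (z : K) (n : nat) :
  q.-primitive_root z ->
  \sum_(1 <= k < q.+1) z ^+ (k * n) = if (q %| n)%N then q%:R else 0.
Proof.
move=> z_prim; rewrite big_add1 big_mkord /=.
under eq_bigr do rewrite mulnC exprM exprS.
rewrite -mulr_sumr (prim_order_dvd z_prim); case: eqP => [->|/eqP zn_neq1].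
  by under eq_bigr do rewrite expr1n; rewrite sumr_const card_ord mul1r.
have /eqP : (z ^+ n - 1) * (\sum_(i < q) (z ^+ n) ^+ i) = 0.
  by rewrite -subrX1 exprAC (prim_expr_order z_prim) expr1n subrr.
by rewrite mulf_eq0 subr_eq0 (negbTE zn_neq1) => /eqP ->; rewrite mulr0.
Qed.

Lemma sum_prim_root_coprime (K : idomainType) (q : nat) (z : K) (n : nat) :
  q.-primitive_root z ->
  \sum_(1 <= k < q.+1 | coprime k q) z ^+ (k * n) =
  \sum_(d <- divisors q | (d %| n)%N) d%:R * (moebius (q %/ d))%:~R.
Proof.
move=> z_prim; have q_gt0 := prim_order_gt0 z_prim.
rewrite sum_coprime // big_divisors_codiv // [RHS]big_mkcond.
apply: eq_big_seq => d; rewrite -dvdn_divisors // => d_q.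
have d_gt0 := dvdn_gt0 q_gt0 d_q.
have qd_gt0 : (0 < q %/ d)%N by rewrite divn_gt0 // dvdn_leq.
rewrite big_nat_dvdn // divnA // mulKn //.
under eq_bigr do rewrite mulnAC mulnC exprM.
rewrite (sum_prim_root_expr _ (dvdn_prim_root z_prim d_q)).
by case: ifP => _; rewrite ?mulr0 // mulrC.
Qed.

Section CircleExponential.
Variable R : realType.
Implicit Types (t u : R) (k n q : nat).

Definition cis t : R[i] := cos t +i* sin t.

Lemma cisD t u : cis (t + u) = cis t * cis u.
Proof.
by apply/eqP; rewrite /cis eq_complex /= cosD sinD [sin t * _ + _]addrC !eqxx.
Qed.

Lemma cis0 : cis 0 = 1.
Proof. by rewrite /cis cos0 sin0. Qed.

Lemma cisMn t n : cis (t *+ n) = cis t ^+ n.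
Proof. by elim: n => [|n IHn]; rewrite ?cis0 // mulrS cisD IHn exprS. Qed.

Lemma cis2pi : cis (pi *+ 2) = 1.
Proof. by rewrite /cis cos2pi sin2pi. Qed.

Lemma cis_neq1 t : 0 < t < pi *+ 2 -> cis t != 1.
Proof.
move=> /andP[t_gt0 t_lt]; apply/eqP => /(congr1 (@complex.Re R)) /= cos_t.
have half_t : 0 < t / 2 < pi by rewrite divr_gt0 //= ltr_pdivrMr // mulr_natr.
have := sin_gt0_pi half_t; have := cos2Dsin2 (t / 2).
move: cos_t; rewrite -{1}[t](@divfK _ 2) // mulr_natr cos_mulr2n; nra.
Qed.

Lemma cis_prim_root q : (0 < q)%N -> q.-primitive_root (cis (pi *+ 2 / q%:R)).
Proof.
move=> q_gt0; have q_neq0 : q%:R != 0 :> R by rewrite pnatr_eq0 -lt0n.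
rewrite /primitive_root_of_unity q_gt0; apply/forallP => i.
rewrite unity_rootE -cisMn -[_ *+ i.+1]mulr_natr mulrAC.
have [->|iq] := eqVneq i.+1 q; first by rewrite mulfK // cis2pi eqxx.
have turn_gt0 : 0 < pi *+ 2 :> R by rewrite pmulrn_lgt0 ?pi_gt0.
apply/eqP/negbTE/cis_neq1; rewrite divr_gt0 ?mulr_gt0 ?ltr0n //=.
by rewrite ltr_pdivrMr ?ltr0n // ltr_pM2l // ltr_nat ltn_neqAle iq ltn_ord.
Qed.

Lemma cexp_cis k n q :
  cexp (2 * pi%:C * 'i%C * k%:R * n%:R / q%:R) =
  cis (pi *+ 2 / q%:R) ^+ (k * n) :> R[i].
Proof.
have -> : 2 * pi%:C * 'i%C * k%:R * n%:R / q%:R =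
    0 +i* (pi *+ 2 / q%:R *+ (k * n)) :> R[i].
  rewrite -!(rmorph_nat (real_complex R)) -fmorphV.
  rewrite -[_ *+ (k * n)]mulr_natr natrM.
  by apply/eqP; rewrite eq_complex /=; apply/andP; split; apply/eqP; ring.
by rewrite /cexp /= expR0 mul1r -cisMn.
Qed.

End CircleExponential.

Section RamanujanSum.
Variable R : realType.
Implicit Types (n q : nat).

Lemma ramanujan_sumE q n : (0 < q)%N ->
  ramanujan_sum R q n =
  \sum_(d <- divisors q | (d %| n)%N) d%:R * (moebius (q %/ d))%:~R.
Proof.
move=> q_gt0; rewrite -(sum_prim_root_coprime n (cis_prim_root R q_gt0)).
by apply: eq_bigr => k _; exact: cexp_cis.
Qed.

Lemma mul_ramanujan_sum2 (c : R[i]) q1 q2 n1 n2 : (0 < q1)%N -> (0 < q2)%N ->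
  c * ramanujan_sum R q1 n1 * ramanujan_sum R q2 n2 =
  \sum_(d1 <- divisors q1) \sum_(d2 <- divisors q2)
    d1%:R * d2%:R * (moebius (q1 %/ d1))%:~R * (moebius (q2 %/ d2))%:~R *
    (if (d1 %| n1)%N && (d2 %| n2)%N then c else 0).
Proof.
move=> q1_gt0 q2_gt0; rewrite !ramanujan_sumE // -mulrA big_distrlr mulr_sumr.
rewrite big_mkcond; apply: eq_bigr => d1 _.
have [d1_n1|_] := boolP (d1 %| n1)%N; last first.
  by rewrite big1 // => d2 _; rewrite mulr0.
rewrite mulr_sumr big_mkcond; apply: eq_bigr => d2 _ /=.
by case: ifP => _; ring.
Qed.

End RamanujanSum.

Lemma cvg_divn2 (d1 d2 : nat) : (0 < d1)%N -> (0 < d2)%N ->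
  (xy.1 %/ d1, xy.2 %/ d2)%N @[xy --> (\oo, \oo)] --> (\oo, \oo).
Proof.
move=> d1_gt0 d2_gt0; pose F := filter_prod (\oo : set_system nat) \oo.
have cvg1 : (xy.1 %/ d1)%N @[xy --> F] --> \oo.
  by apply: cvg_comp (cvg_divnr _ d1_gt0); exact: cvg_fst.
have cvg2 : (xy.2 %/ d2)%N @[xy --> F] --> \oo.
  by apply: cvg_comp (cvg_divnr _ d2_gt0); exact: cvg_snd.
exact: (cvg_pair cvg1 cvg2).
Qed.

Section HasSum2.
Variable R : realType.
Implicit Types (u : nat -> nat -> R[i]) (s : R[i]).

Lemma has_sum2Z c u s : has_sum2 u s -> has_sum2 (fun m n => c * u m n) (c * s).
Proof.
rewrite /has_sum2 => us.
have -> : partial_sum2 (fun m n => c * u m n) =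
          (fun xy => c * partial_sum2 u xy).
  apply/funext => xy; rewrite /partial_sum2 mulr_sumr.
  by apply: eq_bigr => k _; rewrite mulr_sumr.
exact: cvgMl_tmp.
Qed.

Lemma has_sum2_sum (I : eqType) (r : seq I) (u : I -> nat -> nat -> R[i])
    (s : I -> R[i]) :
  (forall i, i \in r -> has_sum2 (u i) (s i)) ->
  has_sum2 (fun m n => \sum_(i <- r) u i m n) (\sum_(i <- r) s i).
Proof.
move=> us; rewrite /has_sum2 big_seq.
have -> : partial_sum2 (fun m n => \sum_(i <- r) u i m n) =
          (fun xy => \sum_(i <- r | i \in r) partial_sum2 (u i) xy).
  apply/funext => xy; rewrite -big_seq /partial_sum2 [RHS]exchange_big.
  by apply: eq_bigr => m _; exact: exchange_big.
by apply: cvg_big => //; exact: add_continuous.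
Qed.

Lemma has_sum2_dvdn d1 d2 u s : (0 < d1)%N -> (0 < d2)%N ->
  has_sum2 (fun k1 k2 => u (k1 * d1)%N (k2 * d2)%N) s ->
  has_sum2 (fun n1 n2 => if (d1 %| n1)%N && (d2 %| n2)%N then u n1 n2 else 0) s.
Proof.
move=> d1_gt0 d2_gt0 us; rewrite /has_sum2.
have -> : partial_sum2
      (fun n1 n2 => if (d1 %| n1)%N && (d2 %| n2)%N then u n1 n2 else 0) =
    partial_sum2 (fun k1 k2 => u (k1 * d1)%N (k2 * d2)%N) \o
      (fun xy => (xy.1 %/ d1, xy.2 %/ d2)%N).
  apply/funext => -[x y]; rewrite /partial_sum2 /=.
  transitivity (\sum_(1 <= n1 < x.+1 | (d1 %| n1)%N)
      \sum_(1 <= n2 < y.+1 | (d2 %| n2)%N) u n1 n2).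
    rewrite [RHS]big_mkcond; apply: eq_bigr => n1 _.
    by case: ifP => _ /=; [rewrite -big_mkcond|rewrite big1].
  by rewrite big_nat_dvdn //; apply: eq_bigr => k1 _; exact: big_nat_dvdn.
exact: cvg_comp (cvg_divn2 d1_gt0 d2_gt0) us.
Qed.

End HasSum2.

Theorem theorem4p2 (R : realType) (a : nat -> nat -> R[i])
    (hA : forall q1 q2 : nat, (0 < q1)%N -> (0 < q2)%N ->
       summable2 (fun k1 k2 : nat => a (k1 * q1)%N (k2 * q2)%N)) :
  forall q1 q2 : nat, (0 < q1)%N -> (0 < q2)%N ->
    has_sum2
      (fun n1 n2 : nat =>
         a n1 n2 * ramanujan_sum R q1 n1 * ramanujan_sum R q2 n2)
      (moebius_transform2 (multiples_sum a) q1 q2).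
Proof.
move=> q1 q2 q1_gt0 q2_gt0; rewrite /moebius_transform2.
under eq_fun2 do rewrite mul_ramanujan_sum2 //.
apply: has_sum2_sum => d1.
rewrite -dvdn_divisors // => /(dvdn_gt0 q1_gt0) d1_gt0.
apply: has_sum2_sum => d2.
rewrite -dvdn_divisors // => /(dvdn_gt0 q2_gt0) d2_gt0.
rewrite /multiples_sum !(mulrAC _ (sum2 _)).
by apply/has_sum2Z/has_sum2_dvdn => //; exact: hA.
Qed.
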